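(* Let $f=[g:g_1,\dots,g_s;h_1,\dots,h_r]$ be a differentiable convertible nonconvex function and let $(\boldsymbol{x}^*,\boldsymbol{y}^* )\in X(g)$. If there are $\boldsymbol{u}^*=(u_1^*,\dots,u_s^* )^\top\ge 0$ and $\boldsymbol{v}^*=(v_1^*,\dots,v_r^* )^\top\ge 0$ such that $$\nabla g(\boldsymbol{x}^*,\boldsymbol{y}^* )+\sum_{i=1}^s u_i^*\nabla g_i(\boldsymbol{x}^*,\boldsymbol{y}^* )+\sum_{j=1}^r v_j^*\nabla h_j(\boldsymbol{x}^*,\boldsymbol{y}^* )=0,\qquad u_i^*g_i(\boldsymbol{x}^*,\boldsymbol{y}^* )=0\ \ (i=1,\dots,s),$$ then $(\boldsymbol{x}^*,\boldsymbol{y}^* )$ is an optimal solution to (CNP) and $\boldsymbol{x}^*$ is an optimal solution to (UOP).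
   Context: Let $f:R^n\to R$ be nonconvex or nonsmooth and let $g,g_i,h_j:R^n\times R^m\to R$ ($i=1,\dots,s$; $j=1,\dots,r$) be convex. Put $X(f)=\{(\boldsymbol{x},\boldsymbol{y}): g_i(\boldsymbol{x},\boldsymbol{y})\le 0\ (i=1,\dots,s),\ h_j(\boldsymbol{x},\boldsymbol{y})=0\ (j=1,\dots,r)\}$, $X(f(\boldsymbol{x}))=\{\boldsymbol{y}\in R^m: (\boldsymbol{x},\boldsymbol{y})\in X(f)\}$ for fixed $\boldsymbol{x}$, and $X(g)=\{(\boldsymbol{x},\boldsymbol{y})\in X(f): g(\boldsymbol{x},\boldsymbol{y})=f(\boldsymbol{x})\}$. The function $f$ is a convertible nonconvex function, written $f=[g:g_1,\dots,g_s;h_1,\dots,h_r]$, if for each $\boldsymbol{x}\in R^n$ there is $\bar{\boldsymbol{y}}\in X(f(\boldsymbol{x}))$ with $f(\boldsymbol{x})=g(\boldsymbol{x},\bar{\boldsymbol{y}})$ and $f(\boldsymbol{x})=\min_{\boldsymbol{y}\in X(f(\boldsymbol{x}))}g(\boldsymbol{x},\boldsymbol{y})$. It is a differentiable convertible nonconvex function if moreover all of $g,g_i,h_j$ are differentiable (with $s>0$); $f$ itself need not be differentiable or convex. (UOP) is the problem: minimize $f(\boldsymbol{x})$ over $\boldsymbol{x}\in R^n$. (CNP) is the problem: minimize $g(\boldsymbol{x},\boldsymbol{y})$ subject to $(\boldsymbol{x},\boldsymbol{y})\in X(f)$. Optimal solution means global optimal solution. Gradients are with respect to $(\boldsymbol{x},\boldsymbol{y})$.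 *)

(* Defs.v *)
From HB Require Import structures.
From mathcomp Require Import all_boot all_order all_algebra.
From mathcomp Require Import all_classical all_reals all_analysis.
Set Implicit Arguments.
Unset Strict Implicit.
Unset Printing Implicit Defensive.
Import Order.TTheory GRing.Theory Num.Theory.
Import numFieldNormedType.Exports.
Local Open Scope classical_set_scope.
Local Open Scope ring_scope.

Definition convex_on_space (R : realType) (E : lmodType R) (F : E -> R) : Prop :=
  convex_function [set: convex_lmodType E] F.

Definition differentiable_everywhere (R : realType) (E : normedModType R)
    (F : E -> R) : Prop :=
  forall p, differentiable F p.

Definition nonconvex_or_nonsmooth (R : realType) (n : nat)
    (f : 'rV[R]_n -> R) : Prop :=
  ~ convex_on_space f \/ ~ differentiable_everywhere f.

(* The vector of all n + m partial derivatives, grouped as the pair formed by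
   the x-block and the y-block. *)
Definition gradient (R : realType) (n m : nat)
    (F : 'rV[R]_n * 'rV[R]_m -> R) (p : 'rV[R]_n * 'rV[R]_m) :
    'rV[R]_n * 'rV[R]_m :=
  (\row_i 'D_(delta_mx 0 i, 0) F p, \row_j 'D_(0, delta_mx 0 j) F p).

Definition optimal_solution (R : realType) (T : Type) (A : set T)
    (F : T -> R) (p : T) : Prop :=
  A p /\ forall q, A q -> F p <= F q.

Definition feasible (R : realType) (n m s r : nat)
    (gi : 'I_s -> 'rV[R]_n * 'rV[R]_m -> R)
    (hj : 'I_r -> 'rV[R]_n * 'rV[R]_m -> R) : set ('rV[R]_n * 'rV[R]_m) :=
  [set p | (forall i, gi i p <= 0) /\ (forall j, hj j p = 0)].

Definition feasible_at (R : realType) (n m s r : nat)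
    (gi : 'I_s -> 'rV[R]_n * 'rV[R]_m -> R)
    (hj : 'I_r -> 'rV[R]_n * 'rV[R]_m -> R) (x : 'rV[R]_n) : set 'rV[R]_m :=
  [set y | feasible gi hj (x, y)].

Definition feasible_eq (R : realType) (n m s r : nat)
    (f : 'rV[R]_n -> R) (g : 'rV[R]_n * 'rV[R]_m -> R)
    (gi : 'I_s -> 'rV[R]_n * 'rV[R]_m -> R)
    (hj : 'I_r -> 'rV[R]_n * 'rV[R]_m -> R) : set ('rV[R]_n * 'rV[R]_m) :=
  [set p | feasible gi hj p /\ g p = f p.1].

(* f = [g : g_1, ..., g_s; h_1, ..., h_r].  The equality functions h_j are only
   required to be convex (not affine), so [feasible gi hj] need not be convex. *)
Definition convertible_nonconvex (R : realType) (n m s r : nat)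
    (f : 'rV[R]_n -> R) (g : 'rV[R]_n * 'rV[R]_m -> R)
    (gi : 'I_s -> 'rV[R]_n * 'rV[R]_m -> R)
    (hj : 'I_r -> 'rV[R]_n * 'rV[R]_m -> R) : Prop :=
  [/\ nonconvex_or_nonsmooth f,
      convex_on_space g,
      forall i, convex_on_space (gi i),
      forall j, convex_on_space (hj j) &
      forall x, exists ybar,
        f x = g (x, ybar) /\
        optimal_solution (feasible_at gi hj x) (fun y => g (x, y)) ybar].

Definition differentiable_convertible_nonconvex (R : realType) (n m s r : nat)
    (f : 'rV[R]_n -> R) (g : 'rV[R]_n * 'rV[R]_m -> R)
    (gi : 'I_s -> 'rV[R]_n * 'rV[R]_m -> R)
    (hj : 'I_r -> 'rV[R]_n * 'rV[R]_m -> R) : Prop :=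
  [/\ convertible_nonconvex f g gi hj,
      (0 < s)%N,
      differentiable_everywhere g,
      forall i, differentiable_everywhere (gi i) &
      forall j, differentiable_everywhere (hj j)].

(* Main.v *)
Require Import Defs.
From HB Require Import structures.
From mathcomp Require Import all_boot all_order all_algebra.
From mathcomp Require Import all_classical all_reals all_analysis ring.
Import Order.TTheory GRing.Theory Num.Theory.
Import numFieldNormedType.Exports.
Local Open Scope classical_set_scope.
Local Open Scope ring_scope.

(** The Karush-Kuhn-Tucker conditions are sufficient here because every function
involved lies above its tangent hyperplanes: for convex differentiable F,
<grad F(p), q - p> <= F q - F p ([gradient_le_increment]).  Pair the
stationarity equation with q - p, where p is the given point and q is feasible.
The multiplier terms are all nonpositive: u_i <grad g_i(p), q - p> is at most
u_i (g_i q - g_i p) = u_i g_i q <= 0 by complementary slackness, and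
v_j <grad h_j(p), q - p> is at most v_j (h_j q - h_j p) = 0.  Hence
<grad g(p), q - p> >= 0, and so g p <= g q.

The sign condition v_j >= 0 is what handles the equality constraints: a convex
h_j vanishing at both p and q has a nonpositive slope at p towards q, and this
slope may be strictly negative, so only a nonnegative multiplier keeps its term
nonpositive.

Optimality passes from g to f because each value f x is attained as g (x, y) at
some feasible (x, y), while f xs = g (xs, ys). *)

(** Along the segment from p to q, convexity bounds each difference quotient
with step t in ]0, 1] by F q - F p; the bound survives the limit t -> 0+. *)
Lemma convex_derive_le {R : realType} {E : normedModType R} {F : E -> R}
    (p q : E) :
  convex_on_space F -> differentiable F p -> 'D_(q - p) F p <= F q - F p.
Proof.
move=> cF dF; have dcv : derivable F p (q - p) by exact: diff_derivable.
(* The derivative is a two-sided limit; only steps to the right stay between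
   p and q. *)
have rcv := cvg_dnbhs_at_right dcv.
rewrite /derive -(cvg_lim _ rcv)//.
apply: limr_le; first by apply/cvg_ex; eexists; exact: rcv.
near=> t.
have t0 : 0 < t by near: t; exact: nbhs_right_gt.
have t1 : t <= 1 by near: t; exact: nbhs_right_le.
have := cF (Itv01 (ltW t0) t1) q p; rewrite !in_setT => /(_ isT isT).
rewrite convRE /conv/= => Fle.
rewrite [X in F X](_ : _ = t *: q + (1 - t) *: p); last first.
  by rewrite scalerBr scalerBl scale1r addrAC addrA.
rewrite [_ *: _]mulrC ler_pdivrMr// lerBlDr (le_trans Fle)//.
by rewrite [leRHS](_ : _ = t * F q + (1 - t) * F p)//; ring.
Unshelve. all: by end_near. Qed.

(** The codomain is R^o so that the pairing with a fixed direction can be declared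
a linear map, which lets it be distributed over the stationarity equation. *)
Definition pairing {R : realType} {n m : nat}
    (v a : 'rV[R]_n * 'rV[R]_m) : R^o :=
  \sum_i v.1 0 i * a.1 0 i + \sum_j v.2 0 j * a.2 0 j.

Lemma pairing_is_linear {R : realType} {n m : nat} (v : 'rV[R]_n * 'rV[R]_m) :
  linear (pairing v).
Proof.
move=> k a b; rewrite /pairing/= scalerDr !scaler_sumr addrACA -!big_split/=.
by congr (_ + _); apply: eq_bigr => i _; rewrite !mxE mulrDr mulrCA.
Qed.

HB.instance Definition _ (R : realType) (n m : nat)
    (v : 'rV[R]_n * 'rV[R]_m) :=
  GRing.isLinear.Build R _ R^o _ (pairing v) (pairing_is_linear v).

Lemma pairingZ {R : realType} {n m : nat} (v : 'rV[R]_n * 'rV[R]_m) (k : R)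
    (a : 'rV[R]_n * 'rV[R]_m) :
  pairing v (k *: a) = k * pairing v a.
Proof. exact: linearZ. Qed.

(** The differential of F is linear, and v is the combination, with its own
coordinates as coefficients, of the basis directions defining the gradient. *)
Lemma derive_gradientE {R : realType} {n m : nat}
    (F : 'rV[R]_n * 'rV[R]_m -> R) (p v : 'rV[R]_n * 'rV[R]_m) :
  differentiable F p -> 'D_v F p = pairing v (gradient F p).
Proof.
move=> dF.
have vE : v = \sum_i v.1 0 i *: (delta_mx 0 i, 0)
            + \sum_j v.2 0 j *: (0, delta_mx 0 j) :> 'rV[R]_n * 'rV[R]_m.
  rewrite [LHS]surjective_pairing [RHS]surjective_pairing.
  rewrite !raddfD/= !raddf_sum/=.
  rewrite [X in (_ + X, _)]big1 ?[X in (_, X + _)]big1 => [|i _|i _]; last 2 first.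
  - by rewrite scaler0.
  - by rewrite scaler0.
  by rewrite addr0 add0r -!row_sum_delta.
rewrite deriveE// {1}vE linearD !linear_sum/=.
rewrite /pairing; congr (_ + _); apply: eq_bigr => i _.
  by rewrite linearZ/= mxE deriveE.
by rewrite linearZ/= mxE deriveE.
Qed.

Lemma gradient_le_increment {R : realType} {n m : nat}
    {F : 'rV[R]_n * 'rV[R]_m -> R} (p q : 'rV[R]_n * 'rV[R]_m) :
  convex_on_space F -> differentiable F p ->
  pairing (q - p) (gradient F p) <= F q - F p.
Proof.
by move=> cF dF; rewrite -derive_gradientE//; exact: convex_derive_le.
Qed.

Theorem theorem2 (R : realType) (n m s r : nat)
    (f : 'rV[R]_n -> R) (g : 'rV[R]_n * 'rV[R]_m -> R)
    (gi : 'I_s -> 'rV[R]_n * 'rV[R]_m -> R)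
    (hj : 'I_r -> 'rV[R]_n * 'rV[R]_m -> R)
    (xs : 'rV[R]_n) (ys : 'rV[R]_m) :
  differentiable_convertible_nonconvex f g gi hj ->
  feasible_eq f g gi hj (xs, ys) ->
  (exists (u : 'cV[R]_s) (v : 'cV[R]_r),
     [/\ forall i, 0 <= u i 0,
         forall j, 0 <= v j 0,
         gradient g (xs, ys)
           + \sum_(i < s) u i 0 *: gradient (gi i) (xs, ys)
           + \sum_(j < r) v j 0 *: gradient (hj j) (xs, ys) = 0 &
         forall i, u i 0 * gi i (xs, ys) = 0]) ->
  optimal_solution (feasible gi hj) g (xs, ys) /\
  optimal_solution [set: 'rV[R]_n] f xs.
Proof.
move=> [[_ cg cgi chj fmin] _ dg dgi dhj] [feas_p gp].
move=> [u [v [u_ge0 v_ge0 stationary slack]]]; set p := (xs, ys) in feas_p gp *.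
have p_opt : optimal_solution (feasible gi hj) g p.
  split=> // q [giq hjq].
  have /(congr1 (pairing (q - p))) := stationary.
  rewrite linear0 !linearD !linear_sum/= => stationary_dir.
  have ineq_le0 i : pairing (q - p) (u i 0 *: gradient (gi i) p) <= 0.
    rewrite pairingZ.
    apply: le_trans (ler_wpM2l (u_ge0 i) (gradient_le_increment p q (cgi i) (dgi i p))) _.
    by rewrite mulrBr slack subr0 mulr_ge0_le0.
  have eq_le0 j : pairing (q - p) (v j 0 *: gradient (hj j) p) <= 0.
    rewrite pairingZ.
    apply: le_trans (ler_wpM2l (v_ge0 j) (gradient_le_increment p q (chj j) (dhj j p))) _.
    by rewrite hjq (proj2 feas_p j) subrr mulr0.
  rewrite -subr_ge0; apply: le_trans (gradient_le_increment p q cg (dg p)).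
  rewrite -stationary_dir -addrA gerDl.
  by rewrite -[leRHS]addr0 lerD ?sumr_le0.
split=> //; split=> // x _.
have [y [-> [feas_y _]]] := fmin x.
by rewrite -gp; exact: (proj2 p_opt).
Qed.
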